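(* Let $(X,\tau)$ be a compact metrizable space and $k$ be a continuous kernel on $X$ with reproducing kernel Hilbert space $H$. Moreover, let $(\lambda_i)_{i\in I}\subset[0,\infty)$ be an (at most countable) family converging to $0$ and $(e_i)_{i\in I}\subset C(X)$ be a family such that $\operatorname{span}\{e_i:i\in I\}$ is dense in $C(X)$ and $$k(x,x')=\sum_{i\in I}\lambda_ie_i(x)e_i(x')$$ holds for all $x,x'\in X$. If there is a strictly positive, finite and regular Borel measure $\nu$ on $X$ such that $([e_i]_\sim)_{i\in I}$ is an orthonormal system in $L_2(\nu)$, then: (i) $k$ is universal if and only if $\lambda_i>0$ for all $i\in I$. (ii) If $e_{i_0}=\mathbf 1_X$ for some $i_0\in I$, then $k$ is characteristic if and only if $\lambda_i>0$ for all $i\ne i_0$. (iii) If $\mathbf 1_X\in H$ and $e_i\ne\mathbf 1_X$ for all $i\in I$, then $k$ is characteristic if and only if $\lambda_i>0$ for all $i\in I$.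
   Context: A kernel on $X$ is a symmetric positive definite function $k:X\times X\to\mathbb R$ (i.e. $\sum_{i,j}a_ia_jk(x_i,x_j)\ge0$ for all finite choices). An at most countable family $(\alpha_i)_{i\in I}\subset[0,\infty)$ converges to $0$ if either $I=\{1,\dots,n\}$, or $I=\mathbb N$ and $\lim_{i\to\infty}\alpha_i=0$. $C(X)$ is the space of continuous real functions with the supremum norm; $\mathbf 1_X$ is the constant function $1$; $[f]_\sim$ is the $\nu$-equivalence class of $f$. A Borel measure is strictly positive if it is positive on every non-empty open set; it is regular if every Borel set is inner regular by compact sets and outer regular by open sets. On a compact space, a continuous kernel with RKHS $H$ is universal if $H$ is dense in $C(X)$. A bounded measurable kernel $k$ with RKHS $H$ is characteristic if the map $P\mapsto\int_Xk(\cdot,x)\,\mathrm dP(x)\in H$ (Pettis integral) is injective on the set $\mathcal M_1(X)$ of Borel probability measures. *)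

(* Defs.v *)
From HB Require Import structures.
From mathcomp Require Import all_boot all_order all_algebra.
From mathcomp Require Import all_classical all_reals all_analysis.

Set Implicit Arguments.
Unset Strict Implicit.
Unset Printing Implicit Defensive.

Import Order.TTheory GRing.Theory Num.Theory.
Import numFieldNormedType.Exports.

Local Open Scope classical_set_scope.
Local Open Scope ring_scope.

Definition metrizable (R : realType) (X : topologicalType) : Prop :=
  exists d : X -> X -> R,
    [/\ forall x y, 0 <= d x y,
        forall x y, d x y = 0 <-> x = y,
        forall x y, d x y = d y x,
        forall x y z, d x z <= d x y + d y z &
        forall (x : X) (A : set X), nbhs x A <->
          exists2 r : R, 0 < r & [set y | d x y < r] `<=` A].

Notation borel X := (g_sigma_algebraType (@open X)).

Section Measures.
Context {R : realType} {X : ptopologicalType}.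

Definition strictly_positive (nu : {measure set (borel X) -> \bar R}) : Prop :=
  forall U : set X, open U -> U !=set0 -> (0 < nu U)%E.

Definition regular_measure (nu : {measure set (borel X) -> \bar R}) : Prop :=
  forall A : set (borel X), measurable A ->
    nu A = ereal_sup [set nu K | K in [set K : set X | compact K /\ K `<=` A]] /\
    nu A = ereal_inf [set nu U | U in [set U : set X | open U /\ A `<=` U]].

(* The inner product of the classes of [e i] and [e j] in L_2(nu) is the
   integral of the product of the representatives. *)
Definition L2_orthonormal (nu : {measure set (borel X) -> \bar R})
    (I : set nat) (e : nat -> X -> R) : Prop :=
  forall i j, I i -> I j ->
    (\int[nu]_x (e i x * e j x)%:E = ((i == j)%:R : R)%:E)%E.

End Measures.

(* At most countable families are indexed by a set [I] of natural numbers,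
   either an initial segment or all of nat; values outside [I] are ignored. *)
Definition family_cvg0 {R : realType} (I : set nat) (lam : nat -> R) : Prop :=
  (exists n, I = `I_n) \/ (I = setT /\ lam @ \oo --> (0 : R)).

Section ContinuousFunctions.
Context {R : realType} {X : topologicalType}.

Definition supnorm (f : X -> R) : R := sup [set `|f x| | x in [set: X]].

(* Density in C(X); [supnorm] is the norm of C(X) only for compact [X]. *)
Definition dense_in_C (S : set (X -> R)) : Prop :=
  (forall f, S f -> continuous f) /\
  (forall f : X -> R, continuous f -> forall eps : R, 0 < eps ->
     exists2 g, S g & supnorm (f \- g) < eps).

Definition span_family (I : set nat) (e : nat -> X -> R) : set (X -> R) :=
  [set f | exists (n : nat) (c : nat -> R),
     f = fun x => \sum_(0 <= i < n | i \in I) c i * e i x].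

End ContinuousFunctions.

Definition is_kernel {R : realType} {X : Type} (k : X -> X -> R) : Prop :=
  (forall x y, k x y = k y x) /\
  (forall (n : nat) (a : 'I_n -> R) (x : 'I_n -> X),
     0 <= \sum_(i < n) \sum_(j < n) a i * a j * k (x i) (x j)).

(* A Hilbert space of functions on [X] is a complete normed space whose norm
   comes from an inner product, together with an injective linear map [rk_eval]
   realizing its elements as functions. [rk_feature x] is k(., x). *)
Record rkhs {R : realType} {X : Type} (k : X -> X -> R) := RKHS {
  rk_space :> completeNormedModType R;
  rk_inner : {dot rk_space for idfun};
  rk_innerE : forall f : rk_space, rk_inner f f = `|f| ^+ 2;
  rk_eval : rk_space -> X -> R;
  rk_eval_linear : forall (a : R) (f g : rk_space) (x : X),
    rk_eval (a *: f + g) x = a * rk_eval f x + rk_eval g x;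
  rk_eval_inj : injective rk_eval;
  rk_feature : X -> rk_space;
  rk_featureE : forall x, rk_eval (rk_feature x) = k ^~ x;
  rk_reproducing : forall (f : rk_space) (x : X),
    rk_eval f x = rk_inner f (rk_feature x)
}.
Arguments rk_eval {R X k} _ _ _.
Arguments rk_inner {R X k} _.
Arguments rk_feature {R X k} _ _.

(* Meant for a continuous kernel on a compact space. *)
Definition universal {R : realType} {X : topologicalType} {k : X -> X -> R}
    (H : rkhs k) : Prop :=
  dense_in_C (range (rk_eval H)).

Definition is_pettis_integral {d : measure_display} {T : measurableType d}
    {R : realType} {E : normedModType R} (mu : {measure set T -> \bar R})
    (f : T -> E) (v : E) : Prop :=
  forall phi : {linear E -> R^o}, continuous phi ->
    mu.-integrable [set: T] (fun x => (phi (f x) : R)%:E) /\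
    ((phi v : R)%:E = \int[mu]_x (phi (f x) : R)%:E)%E.

Section Characteristic.
Context {R : realType} {X : ptopologicalType} {k : X -> X -> R} (H : rkhs k).

(* The default value 0 is only taken when the Pettis integral does not exist,
   which cannot happen for a bounded measurable kernel. *)
Definition mean_embedding (P : probability (borel X) R) : H :=
  xget 0 [set h : H | is_pettis_integral P (rk_feature H) h].

(* Meant for a bounded measurable kernel. Equality of measures is equality on
   measurable sets, since a [probability] is a function on all sets and its
   values on non-measurable ones are unconstrained. *)
Definition characteristic : Prop :=
  forall P Q : probability (borel X) R,
    mean_embedding P = mean_embedding Q ->
    forall A : set (borel X), measurable A -> P A = Q A.

End Characteristic.

(* Main.v *)
(** By dominated convergence, [lam j * e j] is the function in [H] that
represents the functional [h |-> \int[nu] h e_j].  So [e j] lies in [H] when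
[lam j > 0], whereas [H] is orthogonal to [e j] in L_2(nu) when [lam j = 0].
If all [lam j] are positive, [H] contains the span of the [e j]; if moreover two
probability measures integrate every element of [H] alike, they agree on C(X)
and hence on Borel sets (the index of the constant function is harmless, since
both measures have mass 1).  If [lam j = 0], then [e j] is not a uniform limit
of elements of [H], and if also [\int[nu] e_j = 0], the normalization of [nu]
and the probability measure with density proportional to [1 + e_j / M],
[M >= |e_j|], are distinct but have the same mean embedding. *)

Require Import Defs.
From HB Require Import structures.
From mathcomp Require Import all_boot all_order all_algebra.
From mathcomp Require Import ring lra.
From mathcomp Require Import all_classical all_reals all_analysis.
From mathcomp Require Import measurable_realfun.

Set Implicit Arguments.
Unset Strict Implicit.
Unset Printing Implicit Defensive.

Import Order.TTheory GRing.Theory Num.Theory.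
Import numFieldNormedType.Exports.

Local Open Scope classical_set_scope.
Local Open Scope ring_scope.

(** * Riesz representation *)

Section Hilbert.
Context {R : realType} {H : completeNormedModType R} (ip : {dot H for idfun}).
Hypothesis ipE : forall f, ip f f = `|f| ^+ 2.

Lemma dotC (f g : H) : ip f g = ip g f.
Proof. by rewrite hermC expr0 mul1r. Qed.

Lemma dotDl (f g h : H) : ip (f + g) h = ip f h + ip g h.
Proof. exact: linearDl. Qed.

Lemma dotZl a (f g : H) : ip (a *: f) g = a * ip f g.
Proof. exact: linearZl_LR. Qed.

Lemma sqr_normD (f g : H) : `|f + g| ^+ 2 = `|f| ^+ 2 + 2 * ip f g + `|g| ^+ 2.
Proof. by rewrite -!ipE dotDl !(dotC _ (f + g)) !dotDl (dotC g f); ring. Qed.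

Lemma sqr_normDZ (f g : H) (t : R) :
  `|f + t *: g| ^+ 2 = `|f| ^+ 2 + 2 * t * ip f g + t ^+ 2 * `|g| ^+ 2.
Proof.
by rewrite sqr_normD dotC dotZl dotC normrZ exprMn (real_normK (num_real _)) mulrA.
Qed.

Lemma linear_term_eq0 (a b : R) : 0 <= a ->
  (forall t, 0 <= 2 * t * b + t ^+ 2 * a) -> b = 0.
Proof.
move=> a0 /(_ (- b / (a + 1))) h.
have a1 : a + 1 != 0 by rewrite gt_eqF// ltr_wpDl.
have : 2 * (- b / (a + 1)) * b + (- b / (a + 1)) ^+ 2 * a =
  - (b ^+ 2 * (a + 2)) / (a + 1) ^+ 2 by field.
move=> e; rewrite {}e mulNr oppr_ge0 pmulr_lle0 in h; last first.
  by rewrite invr_gt0 exprn_gt0// ltr_wpDl.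
rewrite pmulr_lle0 in h; last by rewrite ltr_wpDl.
by apply/eqP; rewrite -sqrf_eq0 eq_le h sqr_ge0.
Qed.

Lemma dot_CauchySchwarz (f g : H) : `|ip f g| <= `|f| * `|g|.
Proof.
have [->|g0] := eqVneq g 0.
  by rewrite dotC -(scale0r f) dotZl mul0r normr0 mulr_ge0.
rewrite -ler_sqr ?nnegrE ?mulr_ge0// (real_normK (num_real _)) exprMn.
(* The vector is [f] minus its orthogonal projection onto the line of [g]. *)
have := sqr_ge0 `|f + (- (ip f g / `|g| ^+ 2)) *: g|.
have n0 : `|g| ^+ 2 != 0 by rewrite expf_neq0// normr_eq0.
rewrite sqr_normDZ.
set A := `|g| ^+ 2 in n0 *.
have -> : `|f| ^+ 2 + 2 * - (ip f g / A) * ip f g + (- (ip f g / A)) ^+ 2 * A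
  = (`|f| ^+ 2 * A - ip f g ^+ 2) / A by field.
by rewrite pmulr_lge0 ?invr_gt0 ?lt_def ?n0 ?sqr_ge0// subr_ge0.
Qed.

Lemma dot_eqr (f g : H) : (forall h, ip h f = ip h g) -> f = g.
Proof.
move=> h; apply/eqP; rewrite -subr_eq0 -normr_eq0 -sqrf_eq0 -ipE.
by rewrite -scaleN1r dotDl dotZl (dotC f) (dotC g) h mulN1r subrr.
Qed.

Lemma dot_Riesz (L : H -> R) (C : R) :
  (forall a f g, L (a *: f + g) = a * L f + L g) ->
  (forall f, `|L f| <= C * `|f|) ->
  exists g, forall f, L f = ip f g.
Proof.
move=> Llin Lbnd.
(* The minimizer of [|v|^2 - 2 L v] represents [L]. *)
pose q v : R := `|v| ^+ 2 - 2 * L v.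
have LZ a f : L (a *: f) = a * L f.
  have L0 : L 0 = 0 by have := Llin 1 0 0; rewrite scale1r addr0 mul1r; lra.
  by rewrite -[a *: f]addr0 Llin L0 addr0.
have LD f g : L (f + g) = L f + L g by rewrite -[f]scale1r Llin mul1r scale1r.
pose m := inf (range q).
have qlb v : m <= q v.
  apply: ge_inf; last by exists v.
  (* Completing the square: [|w|^2 - 2 C |w| >= - C^2], whatever the sign of [C]. *)
  exists (- C ^+ 2) => _ [w _ <-]; rewrite /q.
  have := Lbnd w; have := ler_norm (L w); have := sqr_ge0 (`|w| - C); nra.
(* Parallelogram identity: minimizing sequences are Cauchy. *)
have mid u v : `|u - v| ^+ 2 <= 2 * (q u - m) + 2 * (q v - m).
  have := qlb (2^-1 *: (u + v)); rewrite /q LZ LD normrZ exprMn.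
  by rewrite -(scaleN1r v) sqr_normDZ sqr_normD normfV normr_nat; nra.
have [v qv] : exists v : nat -> H, forall n, q (v n) < m + n.+1%:R^-1.
  suff h n : exists w, q w < m + n.+1%:R^-1.
    by exists (fun n => sval (cid (h n))) => n; case: cid.
  have : has_inf (range q).
    split; first by exists (q 0), 0.
    by exists m => _ [w _ <-].
  have n0 : 0 < n.+1%:R^-1 :> R by rewrite invr_gt0.
  by move=> /(inf_adherent n0)[_ [w _ <-]]; exists w.
have vcvg : cvg (v @ \oo).
  apply/cauchy_cvgP/cauchy_exP => e e0.
  (* [mid] bounds the squared distance by twice the sum of two gaps; gaps below [e ^+ 2 / 4] keep it
     below [e ^+ 2]. *)
  have e1 : 0 < e ^+ 2 / 4 by rewrite divr_gt0 ?exprn_gt0.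
  have [N _ hN] := near_infty_natSinv_lt (PosNum e1).
  exists (v N), N => // n /= Nn; rewrite -ball_normE /=.
  rewrite -ltr_sqr ?nnegrE ?normr_ge0 ?(ltW e0)//.
  have := mid (v N) (v n); have := qv N; have := qv n.
  have /= := hN N (leqnn N); have /= := hN n Nn.
  by move: n.+1%:R^-1 N.+1%:R^-1 (e ^+ 2) => a b c; lra.
pose h := lim (v @ \oo).
have vh : v @ \oo --> h by [].
have Lvh : L (v n) @[n --> \oo] --> L h.
  apply/cvgrPdist_lt => e e0.
  have C0 : 0 < `|C| + 1 by rewrite ltr_wpDl.
  have /cvgrPdist_lt/(_ (e / (`|C| + 1)) (divr_gt0 e0 C0)) := vh.
  apply: filterS => n; rewrite ltr_pdivlMr// => hn.
  have -> : L h - L (v n) = L (h - v n) by rewrite LD -(scaleN1r (v n)) LZ mulN1r.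
  apply: le_lt_trans hn; apply: (le_trans (Lbnd _)); rewrite mulrC ler_wpM2l//.
  by have := ler_norm C; lra.
have qh : q h <= m.
  have mcvg : m + n.+1%:R^-1 @[n --> \oo] --> m + 0.
    by apply: cvgD; [exact: cvg_cst|exact: cvg_harmonic].
  have qcvg : q (v n) @[n --> \oo] --> q h.
    apply: cvgB; last by apply: cvgMr.
    by under eq_fun do rewrite expr2; apply: cvgM; exact: cvg_norm.
  rewrite -[m]addr0; apply: (ler_cvg_to qcvg mcvg).
  by apply: nearW => n; exact/ltW/qv.
exists h => w.
(* First-order condition at the minimizer: [q (h - t *: w) - q h] is a nonnegative quadratic in [t]
   without constant term, and its linear coefficient is [2 * (L w - ip h w)]. *)
suff : L w - ip h w = 0 by rewrite (dotC w); lra.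
apply: (@linear_term_eq0 (`|w| ^+ 2)); rewrite ?sqr_ge0// => t.
have := qlb (h - t *: w); rewrite /q -scaleNr sqr_normDZ LD LZ.
move: qh; rewrite /q; lra.
Qed.

End Hilbert.

(** * Integration on metrizable compact spaces *)

Section Density.
Context d {T : measurableType d} {R : realType}.
Variables (mu : {finite_measure set T -> \bar R}) (f : T -> R).
Hypotheses (f0 : forall x, 0 <= f x) (intf : mu.-integrable [set: T] (EFin \o f)).

(** The two proofs are arguments so that the term itself carries what its measure and finite-measure
    instances rest on. *)
Definition density & (forall x, 0 <= f x) & mu.-integrable [set: T] (EFin \o f) :=
  fun A : set T => (\int[mu]_(x in A) (f x)%:E)%E.

Local Notation dens := (density f0 intf).

Let dens0 : dens set0 = 0%E.
Proof. exact: integral_set0. Qed.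

Let dens_ge0 A : (0 <= dens A)%E.
Proof. by apply: integral_ge0 => x _; rewrite lee_fin. Qed.

Let dens_sigma_additive : semi_sigma_additive dens.
Proof.
apply: semi_sigma_additive_nng_induced => [|x]; last by rewrite lee_fin.
exact: measurable_funS (measurable_int _ intf).
Qed.

HB.instance Definition _ := isMeasure.Build _ _ _ dens
  dens0 dens_ge0 dens_sigma_additive.

Let dens_fin : fin_num_fun dens.
Proof.
move=> A mA; apply: integrable_fin_num => //.
exact: integrableS intf.
Qed.

HB.instance Definition _ := Measure_isFinite.Build _ _ _ dens dens_fin.

Lemma density_dominated : dens `<< mu.
Proof.
apply/null_content_dominatesP => A mA A0.
apply: null_set_integral => //.
exact: measurable_funS (measurable_int _ intf).
Qed.

(** Change of variables holds with the Radon-Nikodym derivative, and [f] equals that derivative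
    almost everywhere because both have the same integral over every measurable set. *)
Lemma integral_density (h : T -> R) : dens.-integrable [set: T] (EFin \o h) ->
  (\int[dens]_x (h x)%:E = \int[mu]_x (h x * f x)%:E)%E.
Proof.
move=> inth.
rewrite -(Radon_Nikodym_change_of_variables density_dominated)//=.
under [RHS]eq_integral do rewrite EFinM.
have mh := measurable_int _ inth.
apply: ae_eq_integral => //.
- apply: emeasurable_funM => //; apply: (measurable_int mu).
  by apply: Radon_Nikodym_integrable; exact: density_dominated.
- by apply: emeasurable_funM => //; exact: measurable_int intf.
- apply: ae_eqe_mul2l => /=.
  apply: integral_ae_eq => //.
  + by apply: Radon_Nikodym_integrable; exact: density_dominated.
  + exact: measurable_int intf.
  + move=> A _ mA; rewrite -Radon_Nikodym_integral//.
    exact: density_dominated.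
Qed.

End Density.

Lemma exists_density d {T : measurableType d} {R : realType}
    (mu : {finite_measure set T -> \bar R}) (f : T -> R) :
    (forall x, 0 <= f x) -> mu.-integrable [set: T] (EFin \o f) ->
    (\int[mu]_x (f x)%:E = 1)%E ->
  exists P : probability T R,
    forall h : T -> R, P.-integrable [set: T] (EFin \o h) ->
      (\int[P]_x (h x)%:E = \int[mu]_x (h x * f x)%:E)%E.
Proof.
move=> f0 intf f1.
pose P0 := Measure_isProbability.Build _ _ _ (density f0 intf) f1.
pose P : probability T R := HB.pack (density f0 intf) P0.
exists P => h; exact: integral_density.
Qed.

(** * Integrability of continuous functions on a compact space *)

Section ContinuousIntegral.
Context {R : realType} {X : ptopologicalType}.

Lemma continuous_measurable (f : X -> R) :
  continuous f -> measurable_fun [set: borel X] f.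
Proof.
move=> /continuousP cf; apply: (measurability _ (RGenOpens.measurableE R)).
move=> _ [_ [a [b ->] <-]]; rewrite setTI.
by apply: sub_sigma_algebra; apply: cf; exact: interval_open.
Qed.

Hypothesis Xcompact : compact [set: X].

Lemma continuous_ub (f : X -> R) : continuous f ->
  exists2 M, 0 < M & forall x, `|f x| <= M.
Proof.
move=> cf.
have /compact_bounded : compact (f @` setT).
  by apply: continuous_compact => //; exact: continuous_subspaceT.
move=> /ex_strict_bound_gt0[M M0 fM]; exists M => // x.
by apply/ltW/fM; exists x.
Qed.

Lemma continuous_integrable (mu : {finite_measure set (borel X) -> \bar R})
  (f : X -> R) : continuous f -> mu.-integrable [set: borel X] (EFin \o f).
Proof.
move=> cf; apply: measurable_bounded_integrable => //.
- by rewrite ltey_eq fin_num_measure.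
- exact: continuous_measurable.
have [M M0 fM] := continuous_ub cf.
by exists M; split => [|r /ltW Mr x _]; [exact: num_real|exact: le_trans Mr].
Qed.

End ContinuousIntegral.

(** * Continuous functions determine Borel probability measures *)

Section Metrizable.
Context {R : realType} {X : ptopologicalType}.

(** Take [min 1 (n * delta x)], where [delta x] is the distance from [x] to the complement of [U];
    it is 1-Lipschitz, and positive exactly on [U]. *)
Lemma metrizable_indicator_approx : metrizable R X -> forall U : set X, open U ->
  exists f : nat -> X -> R,
    [/\ forall n, continuous (f n), forall n x, 0 <= f n x <= 1 &
        forall x, f ^~ x @ \oo --> (\1_U x : R)].
Proof.
move=> [d [d0 d_eq0 dC d_tri d_nbhs]] U oU.
(* For [U] the whole space, [delta] would be the infimum of the empty set, which takes a default
   value; constant functions serve instead. *)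
have [UT|/existsPNP[z _ zU]] := pselect (forall x, True -> U x).
  exists (fun=> cst 1); split => [n|n x|x]; first exact: cst_continuous.
  - by rewrite ler01 lexx.
  - by rewrite indicE mem_set; [exact: cvg_cst|exact: UT].
pose D x := [set d x y | y in ~` U].
have Dlb x : has_inf (D x).
  by split; [exists (d x z), z|exists 0 => _ [y _ <-]].
pose delta x := inf (D x).
have delta_ge0 x : 0 <= delta x.
  by apply: lb_le_inf; [exact: (Dlb x).1|move=> _ [y _ <-]].
have delta_lip x y : delta x <= d x y + delta y.
  rewrite -lerBlDl; apply: lb_le_inf; first exact: (Dlb y).1.
  move=> _ [w Uw <-]; rewrite lerBlDl; apply: le_trans (d_tri x y w).
  by apply: ge_inf; [exact: (Dlb x).2|exists w].
have delta_cont : continuous delta.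
  move=> x; apply/cvgrPdist_lt => e e0; rewrite near_nbhs; apply/d_nbhs.
  exists e => // y /= xy; apply: le_lt_trans xy.
  have := delta_lip x y; have := delta_lip y x; rewrite (dC y x) => h1 h2.
  by rewrite ler_norml; apply/andP; split; lra.
exists (fun n x => Num.min 1 (n%:R * delta x)); split => [n x|n x|x].
- apply: (@continuous_min _ _ (cst 1) (fun y => n%:R * delta y)).
    exact: cst_continuous.
  by apply: cvgMr; exact: delta_cont.
- by rewrite le_min ler01 mulr_ge0//= ge_min lexx.
- have [Ux|Ux] := pselect (U x); last first.
    rewrite indicE memNset//; have -> : delta x = 0.
      apply/le_anti; rewrite delta_ge0 andbT -((d_eq0 x x).2 erefl).
      by apply: ge_inf; [exact: (Dlb x).2|exists x].
    by under eq_fun do rewrite mulr0 (min_idPr ler01); exact: cvg_cst.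
  rewrite indicE mem_set//.
  have dx : 0 < delta x.
    have /d_nbhs[r r0 rU] : nbhs x U by exact: open_nbhs_nbhs.
    apply: (lt_le_trans r0); apply: lb_le_inf; first exact: (Dlb x).1.
    by move=> _ [y Uy <-]; rewrite leNgt; apply/negP => /rU.
  apply: cvg_near_cst; near=> n.
  apply/min_idPl; rewrite -ler_pdivrMr// mul1r; near: n.
  exact: nbhs_infty_ger.
Unshelve. all: by end_near. Qed.

(** The open sets are closed under finite intersection and generate the Borel sets, so measure
    uniqueness applies. *)
Lemma eq_probability_open (P Q : probability (borel X) R) :
  (forall U : set X, open U -> P U = Q U) ->
  forall A : set (borel X), measurable A -> P A = Q A.
Proof.
move=> PQ.
apply: (@measure_unique _ R (borel X) (@open X) (fun=> setT) _ _ _ _ P Q) => //.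
- by move=> A B; exact: openI.
- by move=> _; exact: openT.
- exact: bigcup_const.
- by move=> _; apply: (le_lt_trans (probability_le1 _ _)); rewrite ?ltry.
Qed.

(** Indicators of open sets are pointwise limits of continuous functions with values in [0, 1], so
    dominated convergence carries the equality to open sets. *)
Lemma eq_probability_continuous (P Q : probability (borel X) R) :
  metrizable R X ->
  (forall f : X -> R, continuous f ->
    (\int[P]_x (f x)%:E = \int[Q]_x (f x)%:E)%E) ->
  forall A : set (borel X), measurable A -> P A = Q A.
Proof.
move=> Xm PQ; apply: eq_probability_open => U oU.
have [f [cf f01 fU]] := metrizable_indicator_approx Xm oU.
have mU : measurable (U : set (borel X)) by exact: sub_sigma_algebra.
have lim (S : probability (borel X) R) :
    (\int[S]_x (f n x)%:E @[n --> \oo] --> S U)%E.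
  have [|||||_ _] := @dominated_convergence _ (borel X) R S setT measurableT
    (fun n x => (f n x)%:E) (fun x => (\1_U x)%:E) (cst 1%E).
  - by move=> n; apply/measurable_EFinP; exact: continuous_measurable.
  - exact/measurable_EFinP/measurable_indic.
  - by apply: aeW => x _; apply: cvg_EFin; [exact: nearW|exact: fU].
  - exact: (finite_measure_integrable_cst S 1).
  - apply: aeW => x n _; rewrite /= lee_fin.
    by have /andP[f0 f1] := f01 n x; rewrite ger0_norm.
  - by rewrite integral_indic// setIT.
have limPQ : (\int[P]_x (f n x)%:E @[n --> \oo] --> Q U)%E.
  rewrite (_ : (fun n => _) = fun n => \int[Q]_x (f n x)%:E)%E; first exact: lim.
  by apply/funext => n; exact: PQ.
exact: cvg_unique (lim P) limPQ.
Qed.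

Hypothesis Xcompact : compact [set: X].

Lemma le_supnorm (f : X -> R) x : continuous f -> `|f x| <= supnorm f.
Proof.
move=> cf; apply: sup_upper_bound; last by exists x.
have [M M0 fM] := continuous_ub Xcompact cf.
by split; [exists `|f point|, point|exists M => _ [y _ <-]].
Qed.

Lemma le_Rintegral_supnorm (P : probability (borel X) R) (f : X -> R) :
  continuous f -> `|\int[P]_x f x| <= supnorm f.
Proof.
move=> cf.
apply: le_trans (le_normr_Rintegral _ _) _ => //; first exact: continuous_integrable.
have -> : supnorm f = \int[P]_x (cst (supnorm f) x).
  rewrite Rintegral_cst// -[LHS]mulr1; congr (_ * _).
  exact/esym/(congr1 fine (probability_setT P)).
apply: le_Rintegral => //.
- apply: (@continuous_integrable _ _ Xcompact P (fun x => `|f x|)) => x.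
  by apply: cvg_norm; exact: cf.
- by apply: (@continuous_integrable _ _ Xcompact P (cst _)) => x; exact: cvg_cst.
- by move=> x _; exact: le_supnorm.
Qed.

Lemma Rintegral_eq_dense (S : set (X -> R)) (P Q : probability (borel X) R) :
  dense_in_C S -> (forall f, S f -> \int[P]_x f x = \int[Q]_x f x) ->
  forall f, continuous f -> \int[P]_x f x = \int[Q]_x f x.
Proof.
move=> [cS dS] PQ f cf; apply/eqP; rewrite -subr_eq0 -normr_le0.
apply/ler_addgt0Pr => e e0; rewrite add0r.
(* The error [f \- g] is integrated against both [P] and [Q], each time costing at most its supremum
   norm. *)
have e2 : 0 < e / 2 by rewrite divr_gt0.
have [g Sg fg] := dS _ cf _ e2; have cg := cS _ Sg.
have cfg : continuous (f \- g) by move=> x; apply: cvgB; [exact: cf|exact: cg].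
have sub (T : probability (borel X) R) :
    \int[T]_x f x = \int[T]_x (f \- g) x + \int[T]_x g x.
  by rewrite RintegralB//; [rewrite subrK|exact: continuous_integrable..].
rewrite (sub P) (sub Q) (PQ _ Sg) opprD addrACA subrr addr0.
apply: (le_trans (ler_normB _ _)).
have := le_Rintegral_supnorm P cfg; have := le_Rintegral_supnorm Q cfg.
lra.
Qed.

End Metrizable.

(** * Finite sums and continuous densities under the integral *)

Section CompactIntegral.
Context {R : realType} {X : ptopologicalType}.
Hypothesis Xcompact : compact [set: X].
Implicit Type mu : {finite_measure set (borel X) -> \bar R}.

Lemma continuous_bigsum (s : seq nat) (P : pred nat) (F : nat -> X -> R) :
  (forall i, P i -> continuous (F i)) ->
  continuous (fun x => \sum_(i <- s | P i) F i x).
Proof.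
move=> cF; elim: s => [|i s IHs].
  rewrite (_ : (fun x => _) = cst 0); first exact: cst_continuous.
  by apply/funext => x; rewrite big_nil.
case: (boolP (P i)) => Pi.
  rewrite (_ : (fun x => _) = F i \+ fun x => \sum_(j <- s | P j) F j x).
    by move=> x; apply: cvgD; [exact: cF|exact: IHs].
  by apply/funext => x; rewrite big_cons Pi.
rewrite (_ : (fun x => _) = fun x => \sum_(j <- s | P j) F j x)//.
by apply/funext => x; rewrite big_cons (negPf Pi).
Qed.

Lemma Rintegral_bigsum mu (s : seq nat) (P : pred nat) (F : nat -> X -> R) :
  (forall i, P i -> continuous (F i)) ->
  \int[mu]_x (\sum_(i <- s | P i) F i x) = \sum_(i <- s | P i) \int[mu]_x F i x.
Proof.
move=> cF; elim: s => [|i s IHs].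
  under eq_Rintegral do rewrite big_nil.
  by rewrite Rintegral_cst// mul0r big_nil.
under eq_Rintegral do rewrite big_cons.
rewrite big_cons; case: (boolP (P i)) => // Pi.
rewrite RintegralD ?IHs//; apply: continuous_integrable => //; first exact: cF.
exact: continuous_bigsum.
Qed.

Lemma RintegralDZ mu (a : R) (f g : X -> R) : continuous f -> continuous g ->
  \int[mu]_x (f x + a * g x) = \int[mu]_x f x + a * \int[mu]_x g x.
Proof.
move=> cf cg; rewrite RintegralD//; last 2 first.
- exact: continuous_integrable.
- by apply: (continuous_integrable Xcompact mu) => x; apply: cvgMr; exact: cg.
by rewrite RintegralZl//; exact: continuous_integrable.
Qed.

Lemma exists_continuous_density mu (f : X -> R) :
  continuous f -> (forall x, 0 <= f x) -> \int[mu]_x f x = 1 ->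
  exists P : probability (borel X) R,
    forall h : X -> R, continuous h -> \int[P]_x h x = \int[mu]_x (h x * f x).
Proof.
move=> cf f0 f1.
have intf := continuous_integrable Xcompact mu cf.
have [|P intP] := @exists_density _ (borel X) R mu f f0 intf.
  by rewrite -[LHS]fineK; [congr EFin|exact: integrable_fin_num].
exists P => h ch; rewrite /Rintegral intP//.
exact: continuous_integrable.
Qed.

End CompactIntegral.

(** * Reproducing kernel Hilbert spaces *)

Section RKHSTheory.
Context {R : realType} {X : ptopologicalType} {k : X -> X -> R} (H : rkhs k).
Hypothesis cont_k : continuous (fun p : X * X => k p.1 p.2).

Local Notation ip := (rk_inner H).
Local Notation ev := (rk_eval H).
Local Notation phi := (rk_feature H).
Let ipC := dotC ip.

Lemma rk_evalD (f g : H) x : ev (f + g) x = ev f x + ev g x.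
Proof. by rewrite !rk_reproducing dotDl. Qed.

Lemma rk_evalZ a (f : H) x : ev (a *: f) x = a * ev f x.
Proof. by rewrite !rk_reproducing dotZl. Qed.

Lemma rk_eval0 x : ev 0 x = 0.
Proof. by rewrite -(scale0r 0) rk_evalZ mul0r. Qed.

Lemma rk_featureK x y : ip (phi x) (phi y) = k y x.
Proof. by rewrite -rk_reproducing rk_featureE. Qed.

Lemma rk_kernelC x y : k x y = k y x.
Proof. by rewrite -!rk_featureK ipC. Qed.

Lemma continuous_diag : continuous (fun x => k x x).
Proof.
move=> x; apply: (@continuous_comp _ _ _ (fun y => (y, y)) (fun p => k p.1 p.2)).
  by apply: cvg_pair; exact: cvg_id.
exact: cont_k.
Qed.

Lemma continuous_kernel y : continuous (k ^~ y).
Proof.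
move=> x; apply: (@continuous_comp _ _ _ (fun z => (z, y)) (fun p => k p.1 p.2)).
  by apply: cvg_pair; [exact: cvg_id|exact: cvg_cst].
exact: cont_k.
Qed.

(** The feature map is continuous, since the squared distance of [phi y] and [phi x] is
    [k y y - 2 k y x + k x x], which tends to 0; Cauchy-Schwarz passes this on to [ev h]. *)
Lemma rk_eval_continuous (h : H) : continuous (ev h).
Proof.
move=> x.
pose G y := k y y + (-2) * k y x + k x x.
have normG y : `|phi y - phi x| ^+ 2 = G y.
  rewrite -(scaleN1r (phi x)) (sqr_normDZ (@rk_innerE _ _ _ H)).
  by rewrite -!rk_innerE !rk_featureK /G (rk_kernelC x y); ring.
have G0 : G y @[y --> x] --> (0 : R).
  have -> : 0 = G x by rewrite /G; ring.
  apply: cvgD; last exact: cvg_cst.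
  apply: cvgD; first exact: continuous_diag.
  by apply: cvgMr; exact: continuous_kernel.
apply/cvgrPdist_lt => e e0.
(* The added 1 allows the division when [h = 0]. *)
have n0 : 0 < `|h| ^+ 2 + 1 by rewrite ltr_wpDl ?sqr_ge0.
have d0 : 0 < e ^+ 2 / (`|h| ^+ 2 + 1) by rewrite divr_gt0 ?exprn_gt0.
have /cvgrPdist_lt/(_ _ d0) := G0.
apply: filterS => y; rewrite sub0r normrN ltr_pdivlMr// => hy.
have := dot_CauchySchwarz (@rk_innerE _ _ _ H) h (phi y - phi x).
rewrite -(scaleN1r (phi x)) ipC dotDl dotZl mulN1r ![ip _ h]ipC.
rewrite -!rk_reproducing scaleN1r distrC => cs; rewrite distrC -ltr_sqr ?nnegrE ?(ltW e0)//.
move: cs; rewrite -ler_sqr ?nnegrE ?mulr_ge0// exprMn normG distrC => cs.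
apply: le_lt_trans hy; apply: (le_trans cs).
have := ler_norm (G y); have := sqr_ge0 `|h|; have := normr_ge0 (G y); nra.
Qed.

Hypothesis Xcompact : compact [set: X].

Lemma rk_eval_bound : exists2 C, 0 < C & forall (h : H) x, `|ev h x| <= C * `|h|.
Proof.
have [M M0 kM] := continuous_ub Xcompact continuous_diag.
have C0 : 0 < M + 1 by rewrite ltr_wpDl ?ltW.
(* The squared norm of [phi x] is [k x x <= M <= (M + 1) ^+ 2], which avoids a square root. *)
exists (M + 1) => // h x; rewrite rk_reproducing mulrC.
apply: (le_trans (dot_CauchySchwarz (@rk_innerE _ _ _ H) _ _)).
rewrite ler_wpM2l// -ler_sqr ?nnegrE ?(ltW C0)// -rk_innerE rk_featureK.
have := ler_norm (k x x); have := kM x; nra.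
Qed.

(** Riesz applies because the functional is bounded by [C] times the integral of [|f|]. The choice
    [f = 1] yields mean embeddings, and [f = e j] the Mercer eigenfunctions. *)
Lemma rk_representer (mu : {finite_measure set (borel X) -> \bar R}) (f : X -> R) :
  continuous f ->
  exists g, forall h, \int[mu]_x (ev h x * f x) = ip h g.
Proof.
move=> cf.
have [C C0 evC] := rk_eval_bound.
have cM h : continuous (fun x => ev h x * f x).
  by move=> x; apply: cvgM; [exact: rk_eval_continuous|exact: cf].
have iM h := continuous_integrable Xcompact mu (cM h).
have cnf : continuous (fun x => `|f x|) by move=> x; apply: cvg_norm; exact: cf.
pose B := C * \int[mu]_x `|f x|.
apply: (@dot_Riesz _ _ _ (@rk_innerE _ _ _ H) _ B) => [a h g|h].
  rewrite -(RintegralZl _ _ (iM h))// -(RintegralD _ _ (iM g))//.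
    by apply: eq_Rintegral => x _; rewrite rk_eval_linear; ring.
  by apply: (continuous_integrable Xcompact mu) => x; apply: cvgMr; exact: cM.
apply: le_trans (le_normr_Rintegral _ (iM h)) _ => //.
rewrite /B mulrAC -RintegralZl//; last exact: continuous_integrable.
apply: le_Rintegral => //.
- apply: (continuous_integrable Xcompact mu) => x; apply: cvg_norm; exact: cM.
- apply: (continuous_integrable Xcompact mu) => x; apply: cvgMr; exact: cnf.
- by move=> x _; rewrite normrM ler_wpM2r.
Qed.

(** Together with its converse [dot_linear_continuous], this turns the functionals that test a
    Pettis integral into inner products. *)
Lemma rk_Riesz (psi : {linear H -> R^o}) : continuous psi ->
  exists g, forall h, psi h = ip h g :> R.
Proof.
move=> /linear_bounded_continuous/linear_boundedP/pinfty_ex_gt0[M _ psiM].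
by apply: (@dot_Riesz _ _ _ (@rk_innerE _ _ _ H) _ M) => // a f g; rewrite linearP.
Qed.

Lemma dot_linear_continuous (g : H) :
  exists2 psi : {linear H -> R^o}, continuous psi & forall h, psi h = ip h g :> R.
Proof.
pose p (h : H) : R^o := ip h g.
have plin : linear p by move=> a u v; rewrite /p dotDl dotZl.
pose psi : {linear H -> R^o} := HB.pack p (GRing.isLinear.Build R H R^o *:%R p plin).
exists psi => //; apply/linear_bounded_continuous/linear_boundedP.
near=> r => h /=; apply: (le_trans (dot_CauchySchwarz (@rk_innerE _ _ _ H) _ _)).
rewrite mulrC ler_wpM2r//.
Unshelve. all: by end_near. Qed.

(** Rules out the default value of [xget]: the Riesz representer of integration against [P] is a
    Pettis integral of the feature map. *)
Lemma mean_embedding_pettis (P : probability (borel X) R) :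
  is_pettis_integral P phi (mean_embedding H P).
Proof.
rewrite /mean_embedding; case: xgetP => [h -> //|nopettis].
have [g gP] := rk_representer P (@cst_continuous _ _ (1 : R)).
exfalso; apply: (nopettis g) => psi /rk_Riesz[u psiu].
have ce : continuous (ev u) by exact: rk_eval_continuous.
have -> : (fun x => (psi (phi x) : R)%:E) = (fun x => (ev u x)%:E).
  by apply/funext => x; rewrite psiu ipC -rk_reproducing.
split; first exact: continuous_integrable.
rewrite psiu ipC -gP /Rintegral fineK.
  by apply: eq_integral => x _; rewrite mulr1.
under eq_integral do rewrite mulr1.
by apply: integrable_fin_num => //; exact: continuous_integrable.
Qed.

Lemma dot_mean_embedding (P : probability (borel X) R) (h : H) :
  ip h (mean_embedding H P) = \int[P]_x ev h x.
Proof.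
have [psi cpsi psih] := dot_linear_continuous h.
have [_ /(congr1 fine) /=] := mean_embedding_pettis P cpsi.
rewrite psih ipC => ->; congr fine; apply: eq_integral => x _.
by rewrite psih ipC -rk_reproducing.
Qed.

(** Reduces [characteristic] to whether integrals of elements of [H] separate probability
    measures. *)
Lemma mean_embedding_eqP (P Q : probability (borel X) R) :
  mean_embedding H P = mean_embedding H Q <->
  forall h : H, \int[P]_x ev h x = \int[Q]_x ev h x.
Proof.
split=> [PQ h|PQ]; first by rewrite -!dot_mean_embedding PQ.
by apply: (dot_eqr (@rk_innerE _ _ _ H)) => h; rewrite !dot_mean_embedding.
Qed.

End RKHSTheory.

(** * Mercer expansion *)

Section Mercer.
Context {R : realType} {X : ptopologicalType}.
Hypothesis Xcompact : compact [set: X].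
Context {k : X -> X -> R}.
Hypothesis cont_k : continuous (fun p : X * X => k p.1 p.2).
Context (H : rkhs k) {I : set nat} {lam : nat -> R} {e : nat -> X -> R}.
Hypothesis lam_ge0 : forall i, I i -> 0 <= lam i.
Hypothesis cont_e : forall i, I i -> continuous (e i).
Hypothesis k_expansion : forall x x' : X,
  (fun n : nat => \sum_(0 <= i < n | i \in I) lam i * e i x * e i x') @ \oo
    --> k x x'.
Context {nu : {finite_measure set (borel X) -> \bar R}}.
Hypothesis e_orthonormal : L2_orthonormal nu I e.

Local Notation ev := (rk_eval H).
Let S n x y := \sum_(0 <= i < n | i \in I) lam i * e i x * e i y.

Let Ie i : i \in I -> continuous (e i).
Proof. by move=> /set_mem; exact: cont_e. Qed.

Lemma Rintegral_orthonormal i j : I i -> I j ->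
  \int[nu]_x (e i x * e j x) = (i == j)%:R.
Proof. by move=> Ii Ij; rewrite /Rintegral e_orthonormal. Qed.

(** On the diagonal the terms are nonnegative, so partial sums stay below [k x x], which is bounded
    by compactness. Off the diagonal, use [2 |a b| <= a^2 + b^2] termwise. *)
Lemma mercer_partial_bound : exists M, forall n x y, `|S n x y| <= M.
Proof.
have [M M0 kM] := continuous_ub Xcompact (continuous_diag cont_k).
have Sd n x : S n x x <= M.
  apply: le_trans (le_trans (ler_norm _) (kM x)).
  have ndS : nondecreasing_seq (fun n => S n x x).
    apply/nondecreasing_seqP => m; rewrite /S big_mkcond [leRHS]big_mkcond/=.
    rewrite big_nat_recr//= lerDl; case: ifPn => // /set_mem Im.
    by rewrite -mulrA mulr_ge0 ?lam_ge0// -expr2 sqr_ge0.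
  have Sk : S m x x @[m --> \oo] --> k x x by exact: k_expansion.
  rewrite -(cvg_lim (@Rhausdorff R) Sk); apply: nondecreasing_cvgn_le => //.
  by apply/cvg_ex; exists (k x x).
exists M => n x y; apply: (@le_trans _ _ ((S n x x + S n y y) / 2)); last first.
  by have := Sd n x; have := Sd n y; lra.
rewrite /S -big_split/= mulr_suml; apply: le_trans (ler_norm_sum _ _ _) _.
apply: ler_sum => i /set_mem /lam_ge0 li.
rewrite -!mulrA !normrM (ger0_norm li) -mulrDr -mulrA ler_wpM2l//.
have := sqr_ge0 (`|e i x| - `|e i y|).
rewrite sqrrB !(real_normK (num_real _)); lra.
Qed.

(** [e j] is an eigenfunction of the integral operator of [k]. The expansion converges only
    pointwise, so sum and integral are exchanged by dominated convergence, with [M * |e j|] as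
    dominating function; orthonormality then leaves the term of index [j]. *)
Lemma mercer_integral j y : I j ->
  \int[nu]_x (k x y * e j x) = lam j * e j y.
Proof.
move=> Ij; have [M SM] := mercer_partial_bound.
have cS n : continuous (fun x => S n x y).
  apply: continuous_bigsum => i Ii x.
  by apply: cvgM; [apply: cvgMr; exact: Ie|exact: cvg_cst].
have intS n : \int[nu]_x (S n x y * e j x) =
    \sum_(0 <= i < n | i \in I) lam i * e i y * (i == j)%:R.
  under eq_Rintegral do rewrite /S mulr_suml.
  rewrite Rintegral_bigsum//; last first.
    move=> i Ii x; apply: cvgM; last exact: cont_e.
    by apply: cvgM; [apply: cvgMr; exact: Ie|exact: cvg_cst].
  apply: eq_bigr => i Ii; rewrite -(Rintegral_orthonormal (set_mem Ii) Ij).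
  rewrite -RintegralZl//; last first.
    apply: (continuous_integrable Xcompact nu) => x.
    by apply: cvgM; [exact: Ie|exact: cont_e].
  by apply: eq_Rintegral => x _; ring.
have lim1 : (\int[nu]_x (S n x y * e j x)%:E)%E @[n --> \oo] -->
    (\int[nu]_x (k x y * e j x)%:E)%E.
  have [|||||_ _] := @dominated_convergence _ (borel X) R nu setT measurableT
    (fun n x => (S n x y * e j x)%:E) (fun x => (k x y * e j x)%:E)
    (fun x => (M * `|e j x|)%:E); last exact.
  - move=> n; apply/measurable_EFinP; apply: continuous_measurable => x.
    by apply: cvgM; [exact: cS|exact: cont_e].
  - apply/measurable_EFinP; apply: continuous_measurable => x.
    by apply: cvgM; [exact: continuous_kernel|exact: cont_e].
  - apply: aeW => x _; apply: cvg_EFin; first exact: nearW.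
    by apply: cvgM; [exact: k_expansion|exact: cvg_cst].
  - apply: (continuous_integrable Xcompact nu) => x.
    by apply: cvgMr; apply: cvg_norm; exact: cont_e.
  - by apply: aeW => x n _; rewrite /= lee_fin normrM ler_wpM2r.
have lim2 : (\int[nu]_x (S n x y * e j x)%:E)%E @[n --> \oo] -->
    (lam j * e j y)%:E.
  (* From [n = j.+1] on, the range of summation contains [j] and the integral no longer changes. *)
  apply: cvg_near_cst; exists j.+1 => // n /= jn.
  rewrite -[LHS]fineK; last first.
    apply: integrable_fin_num => //; apply: (continuous_integrable Xcompact nu) => x.
    by apply: cvgM; [exact: cS|exact: cont_e].
  congr EFin; rewrite -/(Rintegral _ _ _) intS big_mkcond.
  rewrite (bigD1_seq j)/= ?mem_index_iota ?iota_uniq// mem_set// eqxx mulr1.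
  by rewrite big1 ?addr0// => i /negPf ->; rewrite mulr0 if_same.
by rewrite /Rintegral (cvg_unique _ lim1 lim2).
Qed.

(** The values of [g] come from pairing it with [phi y]: this integrates [k ^~ y] against [e j]. *)
Lemma mercer_representer j : I j -> exists2 g : H,
  forall h, \int[nu]_x (ev h x * e j x) = rk_inner H h g &
  forall y, ev g y = lam j * e j y.
Proof.
move=> Ij; have [g gE] := rk_representer H cont_k Xcompact nu (cont_e Ij).
exists g => // y; rewrite rk_reproducing dotC -gE -mercer_integral//.
by apply: eq_Rintegral => x _; rewrite rk_featureE (rk_kernelC H).
Qed.

(** The representer of [e j] evaluates to the zero function, so it is the zero vector by injectivity
    of [ev]. *)
Lemma rk_orthogonal j : I j -> lam j = 0 ->
  forall h, \int[nu]_x (ev h x * e j x) = 0.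
Proof.
move=> Ij lj h; have [g gE evg] := mercer_representer Ij.
have -> : \int[nu]_x (ev h x * e j x) = rk_inner H h 0.
  rewrite gE; congr (rk_inner H h _); apply: (@rk_eval_inj _ _ _ H).
  by apply/funext => x; rewrite evg lj mul0r rk_eval0.
by rewrite dotC -(scale0r 0) dotZl mul0r.
Qed.

Lemma rk_eval_eigen j : I j -> 0 < lam j -> exists h : H, forall x, ev h x = e j x.
Proof.
move=> Ij lj; have [g _ evg] := mercer_representer Ij.
by exists ((lam j)^-1 *: g) => x; rewrite rk_evalZ evg mulKf// gt_eqF.
Qed.

Lemma span_sub_rkhs : (forall i, I i -> 0 < lam i) ->
  span_family I e `<=` range ev.
Proof.
move=> lam_gt0 _ [n [c ->]]; set s := index_iota 0 n.
suff [h hE] : exists h : H, forall x, ev h x = \sum_(i <- s | i \in I) c i * e i x.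
  by exists h => //; apply/funext.
elim: s => [|i s [h hE]]; first by exists 0 => x; rewrite big_nil rk_eval0.
have [/set_mem Ii|Ii] := boolP (i \in I).
  have [hi hiE] := rk_eval_eigen Ii (lam_gt0 _ Ii).
  exists (c i *: hi + h) => x.
  by rewrite big_cons mem_set// rk_evalD rk_evalZ hiE hE.
by exists h => x; rewrite big_cons (negPf Ii).
Qed.

Hypothesis dense_e : dense_in_C (span_family I e).

(** If [lam j = 0], orthogonality gives [1 = \int (e j - h) e j <= supnorm (e j - h) * \int |e j|]
    for every [h] in [H], which keeps [e j] away from [H]. *)
Lemma universal_eigen_gt0 : universal H <-> (forall i, I i -> 0 < lam i).
Proof.
split=> [[_ dH] j Ij|lam_gt0]; last first.
  split=> [_ [h _ <-]|f cf eps eps0]; first exact: rk_eval_continuous.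
  have [g /(span_sub_rkhs lam_gt0) gH fg] := dense_e.2 f cf eps eps0.
  by exists g.
rewrite lt_def lam_ge0// andbT; apply/eqP => lj.
have ce := cont_e Ij.
have cne : continuous (fun x => `|e j x|) by move=> x; apply: cvg_norm; exact: ce.
pose C := \int[nu]_x `|e j x|.
have C0 : 0 <= C by exact: Rintegral_ge0.
(* With this tolerance the upper bound becomes [C / (C + 1) < 1]. *)
have d0 : 0 < (C + 1)^-1 by rewrite invr_gt0 ltr_wpDl.
have [_ [h _ <-] eh] := dH _ ce _ d0.
have ch := rk_eval_continuous cont_k (h := h).
have ceh : continuous (e j \- ev h) by move=> x; apply: cvgB; [exact: ce|exact: ch].
have cM (f g : X -> R) : continuous f -> continuous g -> continuous (fun x => f x * g x).
  by move=> cf cg x; apply: cvgM; [exact: cf|exact: cg].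
have : 1 = \int[nu]_x ((e j \- ev h) x * e j x).
  transitivity (\int[nu]_x (e j x * e j x + (-1) * (ev h x * e j x))).
    rewrite RintegralDZ//; [|exact: cM|exact: cM].
    by rewrite (rk_orthogonal Ij lj) Rintegral_orthonormal// eqxx mulr0 addr0.
  by apply: eq_Rintegral => x _ /=; ring.
move=> eq1; have : 1 <= supnorm (e j \- ev h) * C.
  rewrite {1}eq1 -RintegralZl//; last exact: continuous_integrable.
  apply: le_Rintegral => //.
  - exact: (continuous_integrable Xcompact nu (cM _ _ ceh ce)).
  - by apply: (continuous_integrable Xcompact nu); apply: cM => // x; exact: cvg_cst.
  - move=> x _; apply: le_trans (ler_norm _) _.
    by rewrite normrM ler_wpM2r// le_supnorm.
apply/negP; rewrite -ltNge.
apply: (@le_lt_trans _ _ ((C + 1)^-1 * C)); first by rewrite ler_wpM2r// ltW.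
by rewrite mulrC ltr_pdivrMr ?mul1r ?ltrDl// ltr_wpDl.
Qed.

(** The condition speaks of integrals of the [e i] and not of the signs of [lam i], so that a
    constant [e i] with [lam i = 0] can also be accommodated. *)
Lemma characteristic_of_eigen : metrizable R X ->
  (forall P Q : probability (borel X) R,
     (forall h : H, \int[P]_x ev h x = \int[Q]_x ev h x) ->
     forall i, I i -> \int[P]_x e i x = \int[Q]_x e i x) ->
  characteristic H.
Proof.
move=> Xm eigPQ P Q /(mean_embedding_eqP H cont_k Xcompact) PQ.
apply: (eq_probability_continuous Xm) => f cf.
have intf (T : probability (borel X) R) :
    (\int[T]_x (f x)%:E = (\int[T]_x f x)%:E)%E.
  rewrite /Rintegral fineK//; apply: integrable_fin_num => //.
  exact: continuous_integrable.
rewrite !intf; congr EFin.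
apply: (Rintegral_eq_dense Xcompact dense_e) => // _ [n [c ->]].
have cce i : i \in I -> continuous (fun x => c i * e i x).
  by move=> Ii x; apply: cvgMr; exact: Ie.
rewrite !Rintegral_bigsum//; apply: eq_bigr => i Ii.
have ie (T : probability (borel X) R) := continuous_integrable Xcompact T (Ie Ii).
rewrite (RintegralZl _ _ (ie P))// (RintegralZl _ _ (ie Q))//; congr (_ * _).
by apply: eigPQ => //; exact: set_mem.
Qed.

Hypothesis nu_pos : strictly_positive nu.

(** The vanishing integral lets a multiple of [e j] be added to a probability density without
    changing its mass. *)
Lemma characteristic_eigen_neq0 j : I j -> \int[nu]_x e j x = 0 ->
  characteristic H -> lam j <> 0.
Proof.
move=> Ij ej0 charH lj.
have ce := cont_e Ij; have [M M0 eM] := continuous_ub Xcompact ce.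
pose V := fine (nu setT).
have V0 : 0 < V.
  (* Strict positivity is applied to the whole space, which is open and contains [point]. *)
  by rewrite fine_gt0// nu_pos/= ?ltey_eq ?fin_num_measure//; [exact: openT|exists point].
have cst_c c : continuous (cst c : X -> R) by move=> x; exact: cvg_cst.
have cM (f g : X -> R) : continuous f -> continuous g -> continuous (fun x => f x * g x).
  by move=> cf cg x; apply: cvgM; [exact: cf|exact: cg].
have V1 : \int[nu]_x (cst V^-1 x) = 1 by rewrite Rintegral_cst// mulVf// gt_eqF.
have [P PE] : exists P : probability (borel X) R,
    forall h : X -> R, continuous h -> \int[P]_x h x = V^-1 * \int[nu]_x h x.
  have [|P PE] := exists_continuous_density Xcompact (cst_c V^-1) _ V1.
    by move=> x; rewrite /= invr_ge0 ltW.
  exists P => h ch; rewrite PE// -RintegralZl//; last exact: continuous_integrable.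
  by apply: eq_Rintegral => x _; rewrite mulrC.
(* The largest factor for which [|e j| <= M] alone guarantees [V^-1 + c * e j >= 0]. *)
pose c := V^-1 / M.
have c0 : 0 < c by rewrite divr_gt0// invr_gt0.
have [Q QE] : exists Q : probability (borel X) R,
    forall h : X -> R, continuous h ->
      \int[Q]_x h x = V^-1 * \int[nu]_x h x + c * \int[nu]_x (h x * e j x).
  have [||| Q QE] := exists_continuous_density Xcompact (mu := nu)
    (f := fun x => V^-1 + c * e j x).
  - by move=> x; apply: cvgD; [exact: cvg_cst|apply: cvgMr; exact: ce].
  - move=> x; have /andP[h _] : - M <= e j x <= M by rewrite -ler_norml eM.
    have -> : V^-1 + c * e j x = V^-1 * ((M + e j x) / M).
      by rewrite /c; field; rewrite !gt_eqF.
    apply: mulr_ge0; first by rewrite invr_ge0 (ltW V0).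
    by apply: divr_ge0; [lra|exact: ltW].
  - by rewrite (RintegralDZ Xcompact nu c (cst_c V^-1) ce) ej0 mulr0 addr0.
  exists Q => h ch; rewrite QE// -RintegralZl//; last exact: continuous_integrable.
  rewrite -(RintegralDZ Xcompact); last 2 first.
  - by move=> x; apply: cvgMr; exact: ch.
  - exact: cM.
  by apply: eq_Rintegral => x _; ring.
have PQ : mean_embedding H P = mean_embedding H Q.
  apply/(mean_embedding_eqP H cont_k Xcompact) => h.
  have ch := rk_eval_continuous cont_k (h := h).
  by rewrite PE// QE// (rk_orthogonal Ij lj) mulr0 addr0.
have : \int[P]_x e j x = \int[Q]_x e j x.
  congr fine; apply: eq_measure_integral => A mA _.
  exact: charH PQ _ mA.
(* The integral of [e j] is 0 under [P], but [c] times the squared norm of [e j], hence [c], under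
   [Q]. *)
rewrite PE// QE// ej0 Rintegral_orthonormal// eqxx mulr0 add0r mulr1.
by move/eqP; rewrite lt_eqF.
Qed.

End Mercer.

(** * Universality and the two criteria for characteristic kernels *)

Theorem corollary3p18 (R : realType) (X : ptopologicalType)
  (Xcompact : compact [set: X]) (Xmetrizable : metrizable R X)
  (k : X -> X -> R) (kernel_k : is_kernel k)
  (cont_k : continuous (fun p : X * X => k p.1 p.2))
  (H : rkhs k)
  (I : set nat) (lam : nat -> R) (e : nat -> X -> R)
  (lam_ge0 : forall i, I i -> 0 <= lam i)
  (lam_cvg0 : family_cvg0 I lam)
  (cont_e : forall i, I i -> continuous (e i))
  (dense_e : dense_in_C (span_family I e))
  (k_expansion : forall x x' : X,
    (fun n : nat => \sum_(0 <= i < n | i \in I) lam i * e i x * e i x') @ \oo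
      --> k x x')
  (nu : {finite_measure set (borel X) -> \bar R})
  (nu_pos : strictly_positive nu) (nu_regular : regular_measure nu)
  (e_orthonormal : L2_orthonormal nu I e) :
  [/\ universal H <-> (forall i, I i -> 0 < lam i),
      forall i0, I i0 -> e i0 = cst 1 ->
        (characteristic H <-> (forall i, I i -> i <> i0 -> 0 < lam i)) &
      (exists h : H, rk_eval H h = cst 1) ->
        (forall i, I i -> e i <> cst 1) ->
        (characteristic H <-> (forall i, I i -> 0 < lam i))].
Proof.
have eigen (P Q : probability (borel X) R) i : I i -> 0 < lam i ->
    (forall h : H, \int[P]_x rk_eval H h x = \int[Q]_x rk_eval H h x) ->
    \int[P]_x e i x = \int[Q]_x e i x.
  move=> Ii li PQ.
  have [h hE] := rk_eval_eigen Xcompact cont_k H lam_ge0 cont_e k_expansion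
    e_orthonormal Ii li.
  by rewrite -(funext hE).
have gt0 i : I i -> lam i <> 0 -> 0 < lam i.
  by move=> Ii /eqP li; rewrite lt_def li lam_ge0.
split.
- by apply: (universal_eigen_gt0 Xcompact cont_k H lam_ge0 cont_e k_expansion
    e_orthonormal dense_e).
- move=> i0 Ii0 e1; split=> [charH i Ii ii0|lam_gt0].
    apply: gt0 => //; apply: (characteristic_eigen_neq0 Xcompact cont_k lam_ge0
      cont_e k_expansion e_orthonormal nu_pos Ii _ charH).
    (* Orthogonality of [e i] to [e i0 = 1] says that [e i] has integral 0. *)
    have <- : (i == i0)%:R = 0 :> R by rewrite (introF eqP ii0).
    rewrite -(Rintegral_orthonormal e_orthonormal Ii Ii0).
    by apply: eq_Rintegral => x _; rewrite e1 mulr1.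
  apply: (characteristic_of_eigen Xcompact cont_k cont_e dense_e) => // P Q PQ i Ii.
  (* At [i0], where [lam i0] may vanish, both integrals are the total mass 1. *)
  have [->|/eqP ii0] := eqVneq i i0; last by apply: eigen => //; exact: lam_gt0.
  rewrite e1 !Rintegral_cst//; congr (_ * fine _).
  by transitivity (1 : \bar R)%E; [|apply: esym]; exact: probability_setT.
- move=> [h h1] _; split=> [charH i Ii|lam_gt0].
    apply: gt0 => // li.
    apply: (characteristic_eigen_neq0 Xcompact cont_k lam_ge0
      cont_e k_expansion e_orthonormal nu_pos Ii _ charH li).
    (* Here [h] is the constant 1 in [H]: as [lam i = 0], [e i] is orthogonal to it, so its integral
       vanishes. *)
    rewrite -(rk_orthogonal Xcompact cont_k lam_ge0 cont_e k_expansion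
      e_orthonormal Ii li h).
    by apply: eq_Rintegral => x _; rewrite h1 mul1r.
  apply: (characteristic_of_eigen Xcompact cont_k cont_e dense_e) => // P Q PQ i Ii.
  by apply: eigen => //; exact: lam_gt0.
Qed.
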